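(* The first-order theory of the structure $\langle\mathbb R;\times\rangle$ is not finitely axiomatizable.
   Context: $\times$ is the usual multiplication of real numbers and the language is $\{\times\}$. The theory of a structure is finitely axiomatizable if there is a finite set of sentences of the language whose logical consequences are exactly the sentences true in the structure. *)

(* Defs.v *)
From Stdlib Require Import Reals List Arith.

(** First-order logic with equality over the language with a single binary
    function symbol.  Variables are named by natural numbers. *)

Inductive term : Type :=
| Var (x : nat)
| Mul (s t : term).

Inductive formula : Type :=
| Eq (s t : term)
| Not (p : formula)
| And (p q : formula)
| Or (p q : formula)
| Imp (p q : formula)
| All (x : nat) (p : formula)
| Ex (x : nat) (p : formula).

Fixpoint occurs (x : nat) (t : term) : Prop :=
  match t with
  | Var y => x = y
  | Mul s t => occurs x s \/ occurs x t
  end.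

Fixpoint free (x : nat) (p : formula) : Prop :=
  match p with
  | Eq s t => occurs x s \/ occurs x t
  | Not p => free x p
  | And p q | Or p q | Imp p q => free x p \/ free x q
  | All y p | Ex y p => x <> y /\ free x p
  end.

Definition sentence (p : formula) : Prop := forall x, ~ free x p.

(** As usual in first-order logic, the domain of a structure is nonempty. *)
Record structure : Type := Structure {
  carrier : Type;
  mul : carrier -> carrier -> carrier;
  carrier_inhabited : inhabited carrier
}.

Definition update {A : Type} (v : nat -> A) (x : nat) (a : A) : nat -> A :=
  fun y => if Nat.eqb y x then a else v y.

Fixpoint eval (M : structure) (v : nat -> carrier M) (t : term) : carrier M :=
  match t with
  | Var x => v x
  | Mul s t => mul M (eval M v s) (eval M v t)
  end.

Fixpoint sat (M : structure) (v : nat -> carrier M) (p : formula) : Prop :=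
  match p with
  | Eq s t => eval M v s = eval M v t
  | Not p => ~ sat M v p
  | And p q => sat M v p /\ sat M v q
  | Or p q => sat M v p \/ sat M v q
  | Imp p q => sat M v p -> sat M v q
  | All x p => forall a, sat M (update v x a) p
  | Ex x p => exists a, sat M (update v x a) p
  end.

(** Only used for sentences, whose satisfaction does not depend on [v]. *)
Definition true_in (M : structure) (p : formula) : Prop :=
  forall v, sat M v p.

Definition theory (M : structure) (p : formula) : Prop :=
  sentence p /\ true_in M p.

Definition logical_consequence (G : list formula) (p : formula) : Prop :=
  forall M : structure, (forall q, In q G -> true_in M q) -> true_in M p.

Definition theory_finitely_axiomatizable (M : structure) : Prop :=
  exists G : list formula,
    (forall q, In q G -> sentence q) /\
    (forall p, sentence p -> (logical_consequence G p <-> theory M p)).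

Definition real_mul : structure := Structure R Rmult (inhabits 0%R).

(* Main.v *)
From Stdlib Require Import Reals ZArith List Arith Lia Lra Classical.
From Stdlib Require Import FunctionalExtensionality ProofIrrelevance.
From Coquelicot Require Import Coquelicot.
Require Import Defs.

Local Open Scope R_scope.

(** The reals satisfy, for every odd [q], the sentence saying that each element
    has a [q]-th root.  Finitely many true sentences cannot imply all of these,
    because for every [N] there is a structure which sentences of complexity at
    most [N] do not distinguish from the reals, and in which some of the roots
    are missing.

    Up to sign, and apart from zero, multiplication of reals is addition of
    logarithms.  So a subgroup [S] of the additive group of the reals gives a
    multiplicative structure, [log_structure]: all reals [x] such that
    [ln |x|] lies in [S].  The reals themselves are the case where [S] is
    everything.  A nonzero element of this structure has a [q]-th root, for
    odd [q], iff its logarithm is divisible by [q] in [S].  With [n := 2 * N!] and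
    [S := Z[1/n]], division by every nonzero integer of absolute value at most
    [N] is possible in [S], whereas division of 1 by the odd number [n + 1] is
    not, [n + 1] being coprime to [n].

    It remains to see that divisibility by small integers is all that a sentence
    of bounded complexity can detect ([sat_transfer]).  This is a
    back-and-forth argument with explicit bounds.  Two assignments [agree] up to
    [N] if corresponding entries have the same sign and the logarithms satisfy
    the same integer linear relations with coefficients of absolute value at
    most [N].  Agreement up to the size of an equation decides that equation.
    Agreement up to [2 * N * N] can be extended to one more value on either
    side, at the price of going down to [N] ([same_relations_extend]): a value
    bound to the old ones by a small relation is matched by solving that
    relation, which needs one division by a small integer; a value bound by no
    small relation is matched by any element that is large compared with the
    old ones.  A structure of the above kind whose [S] is divisible up to [N]
    therefore satisfies the same sentences of complexity at most [N] as the
    reals. *)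

(** * Integer linear relations between reals *)

Lemma compose_update {A B : Type} (f : A -> B) (v : nat -> A) (x : nat) (a : A) :
  (fun i => f (update v x a i)) = update (fun i => f (v i)) x (f a).
Proof.
  apply functional_extensionality; intros i; unfold update.
  now destruct (Nat.eqb i x).
Qed.

Lemma update_eq {A : Type} (v : nat -> A) (x : nat) (a : A) : update v x a x = a.
Proof. unfold update; now rewrite Nat.eqb_refl. Qed.

Definition lincomb (m : nat) (k : nat -> Z) (v : nat -> R) : R :=
  sum_f_R0 (fun i => IZR (k i) * v i) m.

Lemma lincomb_update (m x : nat) (k : nat -> Z) (v : nat -> R) (a : R) :
  (x <= m)%nat ->
  lincomb m k (update v x a) = lincomb m (update k x 0%Z) v + IZR (k x) * a.
Proof.
  unfold lincomb; intros Hx.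
  assert (Hlow : forall n, (n < x)%nat ->
    sum_f_R0 (fun i => IZR (k i) * update v x a i) n
    = sum_f_R0 (fun i => IZR (update k x 0%Z i) * v i) n).
  { intros n Hn; apply sum_eq; intros i Hi; unfold update.
    destruct (Nat.eqb_spec i x); [lia | reflexivity]. }
  induction m as [|m IH]; simpl.
  - replace x with 0%nat by lia; rewrite !update_eq; ring.
  - destruct (Nat.eq_dec x (S m)) as [->|Hne].
    + rewrite Hlow by lia; rewrite !update_eq; ring.
    + rewrite IH by lia; unfold update.
      destruct (Nat.eqb_spec (S m) x); [lia | ring].
Qed.

(** The form with two multipliers is the one in which a variable is eliminated
    between two relations, and in which two terms are compared. *)
Lemma lincomb_sub (m : nat) (c d : Z) (k l : nat -> Z) (v : nat -> R) :
  lincomb m (fun i => c * k i - d * l i)%Z v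
  = IZR c * lincomb m k v - IZR d * lincomb m l v.
Proof.
  unfold lincomb; rewrite !scal_sum, <- minus_sum.
  apply sum_eq; intros i _; rewrite minus_IZR, !mult_IZR; ring.
Qed.

Definition bounded (N : nat) (k : nat -> Z) : Prop :=
  forall i, (Z.abs (k i) <= Z.of_nat N)%Z.

Lemma bounded_update_0 (N x : nat) (k : nat -> Z) :
  bounded N k -> bounded N (update k x 0%Z).
Proof. intros Hk i; unfold update; specialize (Hk i); destruct (Nat.eqb i x); lia. Qed.

Definition same_relations (m N : nat) (v w : nat -> R) : Prop :=
  forall k, bounded N k -> (lincomb m k v = 0 <-> lincomb m k w = 0).

(** Containing 1 is what makes the subgroup unbounded, hence provides values
    free from small relations. *)
Record divisible_subgroup (N : nat) (S : R -> Prop) : Prop := {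
  dsub_one : S 1;
  dsub_sub : forall x y, S x -> S y -> S (x - y);
  dsub_div : forall (k : Z) x,
    k <> 0%Z -> (Z.abs k <= Z.of_nat N)%Z -> S x -> S (x / IZR k)
}.

Lemma dsub_zero N S : divisible_subgroup N S -> S 0.
Proof.
  intros HS; replace 0 with (1 - 1) by ring.
  apply (dsub_sub _ _ HS); apply (dsub_one _ _ HS).
Qed.

Lemma dsub_opp N S x : divisible_subgroup N S -> S x -> S (- x).
Proof.
  intros HS Hx; replace (- x) with (0 - x) by ring.
  apply (dsub_sub _ _ HS); [apply (dsub_zero _ _ HS) | exact Hx].
Qed.

Lemma dsub_add N S x y : divisible_subgroup N S -> S x -> S y -> S (x + y).
Proof.
  intros HS Hx Hy; replace (x + y) with (x - - y) by ring.
  apply (dsub_sub _ _ HS); [exact Hx | apply (dsub_opp _ _ _ HS Hy)].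
Qed.

Lemma dsub_mul_nat N S x n : divisible_subgroup N S -> S x -> S (INR n * x).
Proof.
  intros HS Hx; induction n as [|n IH].
  - rewrite Rmult_0_l; apply (dsub_zero _ _ HS).
  - rewrite S_INR, Rmult_plus_distr_r, Rmult_1_l.
    now apply (dsub_add _ _ _ _ HS).
Qed.

Lemma dsub_mul_Z N S x z : divisible_subgroup N S -> S x -> S (IZR z * x).
Proof.
  intros HS Hx; destruct (Z.abs_or_opp_abs z) as [E|E]; rewrite E.
  - rewrite <- Zabs2Nat.id_abs, <- INR_IZR_INZ; now apply (dsub_mul_nat _ _ _ _ HS).
  - rewrite <- Zabs2Nat.id_abs, opp_IZR, <- INR_IZR_INZ, Ropp_mult_distr_l_reverse.
    apply (dsub_opp _ _ _ HS); now apply (dsub_mul_nat _ _ _ _ HS).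
Qed.

Lemma dsub_lincomb N S m k v :
  divisible_subgroup N S -> (forall i, S (v i)) -> S (lincomb m k v).
Proof.
  intros HS Hv; unfold lincomb; induction m as [|m IH]; simpl.
  - now apply (dsub_mul_Z _ _ _ _ HS).
  - apply (dsub_add _ _ _ _ HS); [exact IH | now apply (dsub_mul_Z _ _ _ _ HS)].
Qed.

Lemma dsub_unbounded N S r : divisible_subgroup N S -> exists a, S a /\ r < a.
Proof.
  intros HS; exists (IZR (up r) * 1); split.
  - apply (dsub_mul_Z _ _ _ _ HS), (dsub_one _ _ HS).
  - rewrite Rmult_1_r; apply archimed.
Qed.

Lemma divisible_subgroup_mono N N' S :
  (N <= N')%nat -> divisible_subgroup N' S -> divisible_subgroup N S.
Proof.
  intros HN [H1 H2 H3]; split; [exact H1 | exact H2 |].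
  intros k x Hk HkN; apply H3; [exact Hk | lia].
Qed.

(** A relation involving [x] serves to remove [x] from any other combination.
    The resulting coefficients depend on the two combinations only, so they are
    the same for two families satisfying the same relation; being differences
    of two products, they at most square the bound on coefficients and double
    it. *)
Lemma lincomb_eliminate (m x : nat) (k l : nat -> Z) (v : nat -> R) (a : R) :
  (x <= m)%nat ->
  lincomb m k (update v x a) = 0 ->
  IZR (k x) * lincomb m l (update v x a)
  = lincomb m (fun i => k x * update l x 0%Z i - l x * update k x 0%Z i)%Z v.
Proof.
  intros Hx; rewrite lincomb_sub, !(lincomb_update m x) by exact Hx; intros H.
  replace (lincomb m (update k x 0%Z) v) with (- (IZR (k x) * a)) by lra; ring.
Qed.

Lemma Rabs_lincomb_le (m N : nat) (k : nat -> Z) (v : nat -> R) :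
  bounded N k ->
  Rabs (lincomb m k v) <= sum_f_R0 (fun i => INR N * Rabs (v i)) m.
Proof.
  intros Hk; eapply Rle_trans; [apply Rsum_abs |].
  apply sum_Rle; intros i _; rewrite Rabs_mult.
  apply Rmult_le_compat_r; [apply Rabs_pos |].
  rewrite <- abs_IZR, INR_IZR_INZ; apply IZR_le, Hk.
Qed.

Lemma same_relations_mono m N N' v w :
  (N <= N')%nat -> same_relations m N' v w -> same_relations m N v w.
Proof. intros HN H k Hk; apply H; intros i; specialize (Hk i); lia. Qed.

(** The extension step of the back-and-forth.  Divisibility is spent on solving
    a small relation for [b], so it concerns the side in which [b] is sought. *)
Lemma same_relations_extend (m N x : nat) (S : R -> Prop) (v w : nat -> R) (a : R) :
  divisible_subgroup N S -> (forall i, S (w i)) -> (x <= m)%nat ->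
  same_relations m (2 * N * N) v w ->
  exists b, S b /\ same_relations m N (update v x a) (update w x b).
Proof.
  intros HS Hw Hx Hvw.
  destruct (classic (exists k, bounded N k /\ k x <> 0%Z /\
              lincomb m k (update v x a) = 0)) as [(k & Hk & Hkx & Hka)|Hfree].
  (* [a] satisfies a relation [k]: define [b] by that relation. *)
  - set (k0 := update k x 0%Z).
    assert (Hkx' : IZR (k x) <> 0) by now apply not_0_IZR.
    set (b := - lincomb m k0 w / IZR (k x)).
    assert (Hkb : lincomb m k (update w x b) = 0).
    { rewrite lincomb_update by exact Hx; fold k0; unfold b; field; exact Hkx'. }
    exists b; split.
    + apply (dsub_div _ _ HS); [exact Hkx | apply Hk |].
      apply (dsub_opp _ _ _ HS), (dsub_lincomb _ _ _ _ _ HS Hw).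
    + intros l Hl.
      assert (Hcancel : forall r, r = 0 <-> IZR (k x) * r = 0).
      { intros r; split; [intros ->; ring |].
        intros H; apply Rmult_integral in H; tauto. }
      rewrite (Hcancel (lincomb m l (update v x a))).
      rewrite (Hcancel (lincomb m l (update w x b))).
      rewrite (lincomb_eliminate m x k l v a Hx Hka).
      rewrite (lincomb_eliminate m x k l w b Hx Hkb).
      apply Hvw; intros i.
      pose proof (bounded_update_0 _ x _ Hl i) as H1.
      pose proof (bounded_update_0 _ x _ Hk i) as H2.
      pose proof (Hk x) as H3; pose proof (Hl x) as H4; fold k0 in H2 |- *.
      assert (H5 : (Z.abs (k x * update l x 0 i) <= Z.of_nat N * Z.of_nat N)%Z)
        by (rewrite Z.abs_mul; apply Z.mul_le_mono_nonneg; lia).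
      assert (H6 : (Z.abs (l x * k0 i) <= Z.of_nat N * Z.of_nat N)%Z)
        by (rewrite Z.abs_mul; apply Z.mul_le_mono_nonneg; lia).
      rewrite !Nat2Z.inj_mul; lia.
  (* [a] is free from small relations: a [b] exceeding every combination of the
     old values with coefficients at most [N] is free from them as well. *)
  - destruct (dsub_unbounded N S (sum_f_R0 (fun i => INR N * Rabs (w i)) m) HS)
      as (b & HSb & Hb).
    exists b; split; [exact HSb |].
    intros l Hl; destruct (Z.eq_dec (l x) 0) as [Hlx|Hlx].
    + rewrite !lincomb_update, Hlx, !Rmult_0_l, !Rplus_0_r by exact Hx.
      apply Hvw; intros i; pose proof (bounded_update_0 _ x _ Hl i); nia.
    + split; intros H; exfalso; [now apply Hfree; exists l |].
      rewrite lincomb_update in H by exact Hx.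
      pose proof (Rabs_lincomb_le m N _ w (bounded_update_0 _ x _ Hl)) as Hle.
      replace (lincomb m (update l x 0%Z) w) with (- (IZR (l x) * b)) in Hle by lra.
      rewrite Rabs_Ropp, Rabs_mult in Hle.
      assert (H1 : 1 <= Rabs (IZR (l x))) by (rewrite <- abs_IZR; apply IZR_le; lia).
      pose proof (Rle_abs b); pose proof (Rabs_pos b); nra.
Qed.

(** * Reals as signs and logarithms *)

Definition log_abs (x : R) : R := ln (Rabs x).

(** This rests on the convention that [ln] vanishes outside the positive reals;
    it puts 0 into every [log_structure] without a separate clause. *)
Lemma log_abs_0 : log_abs 0 = 0.
Proof.
  unfold log_abs, ln; rewrite Rabs_R0.
  destruct (Rlt_dec 0 0) as [H|_]; [exfalso; exact (Rlt_irrefl 0 H) | reflexivity].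
Qed.

(** Zero has to be excluded, as [log_abs 0] is 0 rather than minus infinity. *)
Lemma log_abs_mult x y :
  x <> 0 -> y <> 0 -> log_abs (x * y) = log_abs x + log_abs y.
Proof.
  intros Hx Hy; unfold log_abs; rewrite Rabs_mult.
  apply ln_mult; now apply Rabs_pos_lt.
Qed.

Lemma log_abs_pow x n : x <> 0 -> log_abs (x ^ n) = INR n * log_abs x.
Proof.
  intros Hx; unfold log_abs; rewrite <- RPow_abs.
  apply ln_pow; now apply Rabs_pos_lt.
Qed.

Lemma sign_eq_0 x : sign x = 0 <-> x = 0.
Proof.
  split; [| intros ->; apply sign_0].
  intros H; destruct (Req_dec x 0) as [E|E]; [exact E |].
  now apply sign_neq_0 in E.
Qed.

Lemma sign_mul_Rabs x : sign x * Rabs x = x.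
Proof.
  destruct (Rtotal_order x 0) as [H|[->|H]].
  - rewrite sign_eq_m1, Rabs_left by exact H; ring.
  - rewrite sign_0; ring.
  - rewrite sign_eq_1, Rabs_right by lra; ring.
Qed.

(** The sign tells zero apart, so the value chosen for its logarithm does no
    harm. *)
Lemma eq_sign_log_abs x y : x = y <-> sign x = sign y /\ log_abs x = log_abs y.
Proof.
  split; [intros ->; tauto |].
  intros [Hs Hl]; destruct (Req_dec x 0) as [Hx|Hx].
  - apply sign_eq_0 in Hx as Hx'; rewrite Hx' in Hs; symmetry in Hs.
    apply (sign_eq_0 y) in Hs; now subst.
  - assert (Hy : y <> 0) by (rewrite <- sign_eq_0, <- Hs, sign_eq_0; exact Hx).
    rewrite <- (sign_mul_Rabs x), <- (sign_mul_Rabs y), Hs; f_equal.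
    apply ln_inv; [now apply Rabs_pos_lt | now apply Rabs_pos_lt | exact Hl].
Qed.

Lemma sign_exp_mul x r : sign (sign x * exp r) = sign x.
Proof.
  rewrite sign_mult, (sign_eq_1 (exp r)), Rmult_1_r by apply exp_pos.
  destruct (Rtotal_order x 0) as [H|[->|H]].
  - rewrite (sign_eq_m1 x H); apply sign_eq_m1; lra.
  - now rewrite !sign_0.
  - rewrite (sign_eq_1 x H); apply sign_eq_1; lra.
Qed.

Lemma log_abs_exp_mul x r : x <> 0 -> log_abs (sign x * exp r) = r.
Proof.
  intros Hx; unfold log_abs.
  rewrite Rabs_mult, (Rabs_right (exp r)) by (left; apply exp_pos).
  replace (Rabs (sign x)) with 1; [now rewrite Rmult_1_l, ln_exp |].
  destruct (Rtotal_order x 0) as [H|[H|H]]; [| contradiction |].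
  - rewrite (sign_eq_m1 x H), Rabs_left; lra.
  - rewrite (sign_eq_1 x H), Rabs_right; lra.
Qed.

(** Working with an embedding into the reals rather than with one concrete
    carrier lets the reals and the proper substructures be handled alike. *)
Record log_embedding (S : R -> Prop) (M : structure) (f : carrier M -> R) : Prop := {
  emb_mul : forall a b, f (mul M a b) = f a * f b;
  emb_inj : forall a b, f a = f b -> a = b;
  emb_image : forall x, (exists a, f a = x) <-> S (log_abs x)
}.

Lemma emb_eval S M f v t :
  log_embedding S M f ->
  f (eval M v t) = eval real_mul (fun i => f (v i)) t.
Proof.
  intros Hf; induction t as [x|s IHs t IHt]; simpl; [reflexivity |].
  now rewrite (emb_mul _ _ _ Hf), IHs, IHt.
Qed.

Lemma log_embedding_real_mul : log_embedding (fun _ => True) real_mul (fun x => x).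
Proof. split; [reflexivity | tauto |]. intros x; split; [tauto | now exists x]. Qed.

(** * Back-and-forth between multiplicative structures *)

Definition agree (m N : nat) (v w : nat -> R) : Prop :=
  (forall i, sign (v i) = sign (w i)) /\
  same_relations m N (fun i => log_abs (v i)) (fun i => log_abs (w i)).

Lemma agree_refl m N v : agree m N v v.
Proof. split; [reflexivity | intros k _; tauto]. Qed.

Lemma agree_mono m N N' v w : (N <= N')%nat -> agree m N' v w -> agree m N v w.
Proof.
  intros HN [Hs Hr]; split; [exact Hs | now apply (same_relations_mono m N N')].
Qed.

Lemma agree_sym m N v w : agree m N v w -> agree m N w v.
Proof.
  intros [Hs Hr]; split; [intros i; symmetry; apply Hs |].
  intros k Hk; symmetry; now apply Hr.
Qed.

(** A zero is matched by zero, and a nonzero value by the number of the same sign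
    whose logarithm is found by the linear extension step. *)
Lemma agree_extend (m N x : nat) (S : R -> Prop) (v w : nat -> R) (a : R) :
  divisible_subgroup N S -> (forall i, S (log_abs (w i))) -> (x <= m)%nat ->
  agree m (2 * N * N) v w ->
  exists b, S (log_abs b) /\ agree m N (update v x a) (update w x b).
Proof.
  intros HS Hw Hx [Hs Hr].
  assert (Hsign : forall b, sign a = sign b ->
            forall i, sign (update v x a i) = sign (update w x b i)).
  { intros b Hb i; unfold update; now destruct (Nat.eqb i x). }
  destruct (Req_dec a 0) as [->|Ha].
  - exists 0; split; [rewrite log_abs_0; apply (dsub_zero _ _ HS) |].
    split; [now apply Hsign |].
    intros k Hk; rewrite !(compose_update log_abs), log_abs_0.
    rewrite !lincomb_update, !Rmult_0_r, !Rplus_0_r by exact Hx.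
    apply Hr; intros i; pose proof (bounded_update_0 _ x _ Hk i); nia.
  - destruct (same_relations_extend m N x S _ _ (log_abs a) HS Hw Hx Hr)
      as (b & Hb & Hab).
    exists (sign a * exp b); rewrite log_abs_exp_mul by exact Ha.
    split; [exact Hb |]; split; [apply Hsign; now rewrite sign_exp_mul |].
    now rewrite !(compose_update log_abs), log_abs_exp_mul by exact Ha.
Qed.

Fixpoint occ (t : term) (i : nat) : Z :=
  match t with
  | Var x => if Nat.eqb i x then 1%Z else 0%Z
  | Mul s t => (occ s i + occ t i)%Z
  end.

Fixpoint size (t : term) : nat :=
  match t with
  | Var _ => 1
  | Mul s t => size s + size t
  end.

Fixpoint term_max_var (t : term) : nat :=
  match t with
  | Var x => x
  | Mul s t => Nat.max (term_max_var s) (term_max_var t)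
  end.

Fixpoint max_var (p : formula) : nat :=
  match p with
  | Eq s t => Nat.max (term_max_var s) (term_max_var t)
  | Not p => max_var p
  | And p q | Or p q | Imp p q => Nat.max (max_var p) (max_var q)
  | All x p | Ex x p => Nat.max x (max_var p)
  end.

(** The agreement of assignments that decides a formula: an equation compares
    monomials whose exponents are at most the size of the terms, and a
    quantifier costs one extension step. *)
Fixpoint coef_bound (p : formula) : nat :=
  match p with
  | Eq s t => size s + size t
  | Not p => coef_bound p
  | And p q | Or p q | Imp p q => Nat.max (coef_bound p) (coef_bound q)
  | All _ p | Ex _ p => 2 * coef_bound p * coef_bound p
  end.

Lemma occ_le_size t i : (0 <= occ t i <= Z.of_nat (size t))%Z.
Proof. induction t as [x|s IHs t IHt]; simpl; [destruct (Nat.eqb i x) |]; lia. Qed.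

(** A term is a monomial, whose logarithm is linear in those of the variables. *)
Lemma log_abs_eval m v t :
  (term_max_var t <= m)%nat -> eval real_mul v t <> 0 ->
  log_abs (eval real_mul v t) = lincomb m (occ t) (fun i => log_abs (v i)).
Proof.
  induction t as [x|s IHs t IHt]; simpl; intros Hm H0.
  - symmetry.
    (* A single variable is its own update, so that [lincomb_update] isolates
       the only nonzero coefficient. *)
    replace (fun i => log_abs (v i))
      with (update (fun i => log_abs (v i)) x (log_abs (v x))).
    + rewrite lincomb_update, Nat.eqb_refl by exact Hm.
      replace (update _ x 0%Z) with (fun _ : nat => (0 * 0 - 0 * 0)%Z).
      * rewrite (lincomb_sub m 0 0 (fun _ => 0%Z) (fun _ => 0%Z)); ring.
      * apply functional_extensionality; intros i; unfold update.
        now destruct (Nat.eqb i x).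
    + apply functional_extensionality; intros i; unfold update.
      destruct (Nat.eqb_spec i x) as [->|_]; reflexivity.
  - assert (Hs : eval real_mul v s <> 0) by (intros E; apply H0; rewrite E; apply Rmult_0_l).
    assert (Ht : eval real_mul v t <> 0) by (intros E; apply H0; rewrite E; apply Rmult_0_r).
    rewrite log_abs_mult, IHs, IHt by (assumption || lia).
    unfold lincomb; rewrite <- plus_sum; apply sum_eq; intros i _.
    rewrite plus_IZR; ring.
Qed.

Lemma sign_eval v w t :
  (forall i, sign (v i) = sign (w i)) ->
  sign (eval real_mul v t) = sign (eval real_mul w t).
Proof.
  intros H; induction t as [x|s IHs t IHt]; simpl; [apply H |].
  now rewrite !sign_mult, IHs, IHt.
Qed.

(** When the terms do not vanish, their equality means equal signs and the
    vanishing of one integer combination of logarithms; when they vanish, the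
    signs alone decide. *)
Lemma agree_atomic m N v w s t :
  (term_max_var s <= m)%nat -> (term_max_var t <= m)%nat ->
  (size s + size t <= N)%nat -> agree m N v w ->
  eval real_mul v s = eval real_mul v t -> eval real_mul w s = eval real_mul w t.
Proof.
  intros Hs Ht HN [Hsg Hr] E.
  pose proof (sign_eval v w s Hsg) as Es; pose proof (sign_eval v w t Hsg) as Et.
  assert (Esg : sign (eval real_mul w s) = sign (eval real_mul w t))
    by (rewrite <- Es, <- Et, E; reflexivity).
  destruct (Req_dec (eval real_mul v s) 0) as [H0|H0].
  - assert (Hw : eval real_mul w s = 0)
      by (apply sign_eq_0; rewrite <- Es; now apply sign_eq_0).
    rewrite Hw; symmetry; apply sign_eq_0; rewrite <- Esg, Hw; apply sign_0.
  - assert (Hz : forall u u', sign u = sign u' -> u <> 0 -> u' <> 0)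
      by (intros u u' Hu H H'; apply H, sign_eq_0; rewrite Hu; now apply sign_eq_0).
    apply eq_sign_log_abs; split; [exact Esg |].
    pose proof (Hz _ _ Es H0) as Hws; pose proof (Hz _ _ Esg Hws) as Hwt.
    apply (f_equal log_abs) in E as El.
    assert (Hvt : eval real_mul v t <> 0) by (rewrite <- E; exact H0).
    rewrite !(log_abs_eval m) in El by assumption.
    rewrite !(log_abs_eval m) by assumption.
    apply Rminus_diag_uniq.
    apply Rminus_diag_eq in El.
    assert (Hd : forall u, lincomb m (fun i => 1 * occ s i - 1 * occ t i)%Z u
                  = lincomb m (occ s) u - lincomb m (occ t) u)
      by (intros u; rewrite lincomb_sub; ring).
    rewrite <- Hd in El |- *; apply Hr; [| exact El].
    intros i; pose proof (occ_le_size s i); pose proof (occ_le_size t i); lia.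
Qed.

Lemma agree_extend_structure m N x S M f (v : nat -> R) (w : nat -> carrier M) (a : R) :
  divisible_subgroup N S -> log_embedding S M f -> (x <= m)%nat ->
  agree m (2 * N * N) v (fun i => f (w i)) ->
  exists b, agree m N (update v x a) (fun i => f (update w x b i)).
Proof.
  intros HS Hf Hx Hvw.
  destruct (agree_extend m N x S v (fun i => f (w i)) a) as (r & Hr & Hag);
    [exact HS | | exact Hx | exact Hvw |].
  - intros i; apply (emb_image _ _ _ Hf); now exists (w i).
  - apply (emb_image _ _ _ Hf) in Hr as [b <-].
    exists b; now rewrite compose_update.
Qed.

(** One implication is enough, because the hypotheses are symmetric in the two
    structures: exchanging them handles negations and premises, and reduces the
    universal quantifier to an extension step in the opposite direction. *)
Lemma sat_transfer (p : formula) (m N : nat) :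
  (max_var p <= m)%nat -> (coef_bound p <= N)%nat ->
  forall S S' M M' f f' v w,
  divisible_subgroup N S -> divisible_subgroup N S' ->
  log_embedding S M f -> log_embedding S' M' f' ->
  agree m N (fun i => f (v i)) (fun i => f' (w i)) ->
  sat M v p -> sat M' w p.
Proof.
  assert (Hquant : forall n, (n <= 2 * n * n)%nat) by (intros n; nia).
  revert N; induction p as [s t|p IHp|p IHp q IHq|p IHp q IHq|p IHp q IHq|x p IHp|x p IHp];
    simpl; intros N Hm HN S S' M M' f f' v w HS HS' Hf Hf' Hvw Hsat.
  - apply (emb_inj _ _ _ Hf'); rewrite !(emb_eval _ _ _ _ _ Hf').
    apply (agree_atomic m N (fun i => f (v i))); [lia | lia | lia | exact Hvw |].
    now rewrite <- !(emb_eval _ _ _ _ _ Hf), Hsat.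
  - intros H; apply Hsat; revert H.
    apply (IHp N Hm HN S' S M' M f' f); try assumption; now apply agree_sym.
  - destruct Hsat as [Hp Hq]; split.
    + apply (IHp N ltac:(lia) ltac:(lia) S S' M M' f f' v w); assumption.
    + apply (IHq N ltac:(lia) ltac:(lia) S S' M M' f f' v w); assumption.
  - destruct Hsat as [Hp|Hq]; [left | right].
    + apply (IHp N ltac:(lia) ltac:(lia) S S' M M' f f' v w); assumption.
    + apply (IHq N ltac:(lia) ltac:(lia) S S' M M' f f' v w); assumption.
  - intros H; apply (IHq N ltac:(lia) ltac:(lia) S S' M M' f f' v w); try assumption.
    apply Hsat; revert H.
    apply (IHp N ltac:(lia) ltac:(lia) S' S M' M f' f); try assumption; now apply agree_sym.
  - intros b.
    destruct (agree_extend_structure m (coef_bound p) x S M f (fun i => f' (w i)) v (f' b))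
      as [a Hab].
    + apply (divisible_subgroup_mono _ N); [specialize (Hquant (coef_bound p)); lia | exact HS].
    + exact Hf.
    + lia.
    + apply agree_sym, (agree_mono m _ N); [exact HN | exact Hvw].
    + rewrite <- compose_update in Hab.
      apply (IHp (coef_bound p) ltac:(lia) ltac:(lia) S S' M M' f f' (update v x a)).
      * apply (divisible_subgroup_mono _ N); [specialize (Hquant (coef_bound p)); lia | exact HS].
      * apply (divisible_subgroup_mono _ N); [specialize (Hquant (coef_bound p)); lia | exact HS'].
      * exact Hf.
      * exact Hf'.
      * now apply agree_sym.
      * apply Hsat.
  - destruct Hsat as [a Ha].
    destruct (agree_extend_structure m (coef_bound p) x S' M' f' (fun i => f (v i)) w (f a))
      as [b Hab].
    + apply (divisible_subgroup_mono _ N); [specialize (Hquant (coef_bound p)); lia | exact HS'].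
    + exact Hf'.
    + lia.
    + apply (agree_mono m _ N); [exact HN | exact Hvw].
    + exists b; rewrite <- compose_update in Hab.
      apply (IHp (coef_bound p) ltac:(lia) ltac:(lia) S S' M M' f f' (update v x a)).
      * apply (divisible_subgroup_mono _ N); [specialize (Hquant (coef_bound p)); lia | exact HS].
      * apply (divisible_subgroup_mono _ N); [specialize (Hquant (coef_bound p)); lia | exact HS'].
      * exact Hf.
      * exact Hf'.
      * exact Hab.
      * exact Ha.
Qed.

(** * A subgroup divisible by small integers only *)

Definition Z_adjoin_inv (n : nat) (x : R) : Prop :=
  exists (j : nat) (a : Z), x * INR n ^ j = IZR a.

Lemma divide_fact k N : (0 < k <= N)%nat -> Nat.divide k (fact N).
Proof.
  induction N as [|N IH]; [lia | intros [Hk HkN]; simpl fact].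
  change (fact N + N * fact N)%nat with (S N * fact N)%nat.
  destruct (Nat.eq_dec k (S N)) as [->|Hne].
  - apply Nat.divide_factor_l.
  - apply Nat.divide_mul_r, IH; lia.
Qed.

Lemma divisible_subgroup_Z_adjoin_inv N n :
  (n <> 0)%nat -> (forall k, (0 < k <= N)%nat -> Nat.divide k n) ->
  divisible_subgroup N (Z_adjoin_inv n).
Proof.
  intros Hn Hdiv; split.
  - exists 0%nat, 1%Z; simpl; ring.
  - intros x y (i & a & Hx) (j & b & Hy).
    exists (i + j)%nat, (a * Z.of_nat n ^ Z.of_nat j - b * Z.of_nat n ^ Z.of_nat i)%Z.
    rewrite minus_IZR, !mult_IZR, <- !pow_IZR, <- INR_IZR_INZ, <- Hx, <- Hy, pow_add; ring.
  - intros k x Hk HkN (j & a & Hx).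
    assert (Hkn : (k | Z.of_nat n)%Z).
    { apply Z.divide_abs_l; rewrite <- Zabs2Nat.id_abs.
      destruct (Hdiv (Z.abs_nat k) ltac:(lia)) as [c Hc].
      exists (Z.of_nat c); lia. }
    destruct Hkn as [c Hc].
    exists (S j), (a * c)%Z.
    rewrite mult_IZR, <- Hx; simpl; rewrite (INR_IZR_INZ n), Hc, mult_IZR.
    field; now apply not_0_IZR.
Qed.

(** If [1 / (n + 1)] were [a / n ^ j], then [n + 1] would divide [n ^ j], to
    which it is coprime. *)
Lemma Z_adjoin_inv_no_div_succ n x :
  (n <> 0)%nat -> Z_adjoin_inv n x -> INR (S n) * x <> 1.
Proof.
  intros Hn (j & a & Hx) H1.
  assert (Hpow : (Z.of_nat (S n) | Z.of_nat n ^ Z.of_nat j)%Z).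
  { exists a; apply eq_IZR; rewrite mult_IZR, <- Hx, <- pow_IZR, <- !INR_IZR_INZ.
    transitivity (INR (S n) * x * INR n ^ j); [rewrite H1 |]; ring. }
  clear Hx; induction j as [|j IH].
  - apply Z.divide_1_r_nonneg in Hpow; lia.
  - apply IH; rewrite (Nat2Z.inj_succ j), Z.pow_succ_r in Hpow by lia.
    apply (Z.gauss _ _ _ Hpow), Z.bezout_1_gcd.
    exists 1%Z, (-1)%Z; lia.
Qed.

(** * Structures without some root *)

Lemma log_abs_mult_closed N S x y :
  divisible_subgroup N S -> S (log_abs x) -> S (log_abs y) -> S (log_abs (x * y)).
Proof.
  intros HS Hx Hy.
  destruct (Req_dec x 0) as [->|Hx0]; [now rewrite Rmult_0_l |].
  destruct (Req_dec y 0) as [->|Hy0]; [now rewrite Rmult_0_r |].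
  rewrite log_abs_mult by assumption; now apply (dsub_add N).
Qed.

Definition log_structure N S (HS : divisible_subgroup N S) : structure :=
  Structure {x : R | S (log_abs x)}
    (fun a b => exist _ (proj1_sig a * proj1_sig b)
                  (log_abs_mult_closed N S _ _ HS (proj2_sig a) (proj2_sig b)))
    (inhabits (exist _ 0 (eq_ind_r S (dsub_zero N S HS) log_abs_0))).

Lemma log_embedding_log_structure N S (HS : divisible_subgroup N S) :
  log_embedding S (log_structure N S HS) (@proj1_sig _ _).
Proof.
  split; [reflexivity | |].
  - intros [a Ha] [b Hb]; simpl; intros E; now apply subset_eq_compat.
  - intros x; split; [intros [[a Ha] <-]; exact Ha | intros Hx; now exists (exist _ x Hx)].
Qed.

(** The exponent is [n + 1], as there is no term for the empty product. *)
Fixpoint power (x n : nat) : term :=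
  match n with
  | O => Var x
  | S n => Mul (Var x) (power x n)
  end.

(** Because of the shift in [power], these are roots of degree [n + 1]. *)
Definition roots_exist (n : nat) : formula := All 0 (Ex 1 (Eq (power 1 n) (Var 0))).

Lemma eval_power v x n : eval real_mul v (power x n) = v x ^ S n.
Proof. induction n as [|n IH]; simpl in *; [ring | now rewrite IH]. Qed.

Lemma sentence_roots_exist n : sentence (roots_exist n).
Proof.
  assert (Hocc : forall x, occurs x (power 1 n) -> x = 1%nat).
  { intros x; induction n as [|k IH]; simpl; intuition. }
  intros x; simpl; intros (H0 & H1 & [H|H]); [now apply H1, Hocc | now apply H0].
Qed.

Lemma odd_root n (y : R) : Nat.Even n -> exists x, x ^ S n = y.
Proof.
  intros [k ->]; exists (sign y * exp (log_abs y / INR (S (2 * k)))).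
  set (x := sign y * _).
  destruct (Req_dec y 0) as [Hy|Hy].
  { unfold x; rewrite Hy, sign_0, Rmult_0_l; simpl; ring. }
  assert (Hx : x <> 0).
  { unfold x; rewrite <- sign_eq_0, sign_exp_mul, sign_eq_0; exact Hy. }
  apply eq_sign_log_abs; split.
  - assert (Hodd : sign (x ^ S (2 * k)) = sign x).
    { rewrite <- tech_pow_Rmult, pow_mult, sign_mult.
      rewrite (sign_eq_1 ((x ^ 2) ^ k)); [ring |].
      apply pow_lt; nra. }
    rewrite Hodd; apply sign_exp_mul.
  - rewrite log_abs_pow by exact Hx; unfold x; rewrite log_abs_exp_mul by exact Hy.
    field; now apply not_0_INR.
Qed.

Lemma theory_roots_exist n : Nat.Even n -> theory real_mul (roots_exist n).
Proof.
  intros Hn; split; [apply sentence_roots_exist |].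
  intros v a; destruct (odd_root n a Hn) as [x Hx]; exists x; simpl.
  now rewrite eval_power.
Qed.

(** A root of [exp 1] would have the logarithm [1 / (n + 1)]. *)
Lemma not_roots_exist n N (HS : divisible_subgroup N (Z_adjoin_inv n)) :
  (n <> 0)%nat -> ~ true_in (log_structure N (Z_adjoin_inv n) HS) (roots_exist n).
Proof.
  intros Hn Htrue.
  pose proof (log_embedding_log_structure N (Z_adjoin_inv n) HS) as Hf.
  assert (He : Z_adjoin_inv n (log_abs (exp 1))).
  { unfold log_abs; rewrite Rabs_right, ln_exp by (left; apply exp_pos).
    apply (dsub_one _ _ HS). }
  pose (e := exist (fun x => Z_adjoin_inv n (log_abs x)) _ He).
  destruct (Htrue (fun _ => e) e) as [b Hb]; simpl in b, Hb.
  apply (f_equal (@proj1_sig _ _)) in Hb.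
  rewrite (emb_eval _ _ _ _ _ Hf), eval_power in Hb.
  unfold update in Hb; simpl Nat.eqb in Hb; cbv iota in Hb.
  destruct b as [b Hbn]; simpl proj1_sig in Hb.
  apply (Z_adjoin_inv_no_div_succ n (log_abs b) Hn Hbn).
  rewrite <- log_abs_pow, Hb.
  - unfold log_abs; rewrite Rabs_right by (left; apply exp_pos); apply ln_exp.
  - intros ->; rewrite pow_i in Hb by lia; pose proof (exp_pos 1); lra.
Qed.

Theorem theorem3p4 : ~ theory_finitely_axiomatizable real_mul.
Proof.
  intros (G & HGs & HG).
  set (N := list_max (map coef_bound G)).
  (* The factor 2 makes the degree [n + 1] odd even if [N] is at most 1, so that
     negative reals have roots of this degree too. *)
  set (n := (2 * fact N)%nat).
  assert (Hn : n <> 0%nat) by (pose proof (fact_neq_0 N); lia).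
  assert (HS : divisible_subgroup N (Z_adjoin_inv n)).
  { apply divisible_subgroup_Z_adjoin_inv; [exact Hn |].
    intros k Hk; apply Nat.divide_mul_r, divide_fact, Hk. }
  apply (not_roots_exist n N HS Hn).
  apply (proj2 (HG _ (sentence_roots_exist n))).
  { apply theory_roots_exist; now exists (fact N). }
  (* An assignment in the substructure is also one in the reals, and agrees with
     itself. *)
  intros q Hq w.
  apply (sat_transfer q (max_var q) N) with
    (S := fun _ => True) (S' := Z_adjoin_inv n) (f := fun x => x) (f' := @proj1_sig _ _)
    (M := real_mul) (v := fun i => proj1_sig (w i)).
  - reflexivity.
  - pose proof (proj1 (list_max_le (map coef_bound G) N) (le_n _)) as Hmax.
    rewrite Forall_forall in Hmax; now apply Hmax, in_map.
  - now split.
  - exact HS.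
  - apply log_embedding_real_mul.
  - apply log_embedding_log_structure.
  - apply agree_refl.
  - apply (proj1 (HG q (HGs q Hq))).
    intros M HM; now apply HM.
Qed.
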